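(* Let $\widetilde{\mathcal{Q}}$ be an extended quiver with even vertices labeled by even cluster variables $x_1,\ldots,x_n$ and odd vertices labeled by odd variables $\xi_1,\ldots,\xi_m$, and define the differential $2$-form $$\omega_{\widetilde{\mathcal{Q}}}=\sum_{x_i\to x_j}\frac{dx_i\wedge dx_j}{x_ix_j}+\sum_{(\xi_i\to x_\ell\to\xi_j)}\frac{d(\xi_i\xi_j)\wedge dx_\ell}{x_\ell},$$ where the first sum runs over the arrows of the underlying quiver and the second over the $2$-paths of $\widetilde{\mathcal{Q}}$ (both with multiplicity). Let $\mu_k$ be the mutation at an even vertex $x_k$, producing the extended quiver $\mu_k(\widetilde{\mathcal{Q}})$ and the new variable $x_k'$ defined by $$x_kx_k'=\prod_{x_k\to x_j}x_j+\Big(1+\sum_{(\xi_i\to x_k\to\xi_j)}\xi_i\xi_j\Big)\prod_{x_i\to x_k}x_i .$$ Then, expressing $x_k$ in terms of $x_k'$ and the other variables via this relation and substituting into $\omega_{\widetilde{\mathcal{Q}}}$, one obtains exactly the form $\omega_{\mu_k(\widetilde{\mathcal{Q}})}$ written in the variables $x_1,\ldots,x_k',\ldots,x_n,\xi_1,\ldots,\xi_m$. That is, $\omega$ is invariant under mutations.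
   Context: An extended quiver consists of a finite quiver $\mathcal{Q}$ with no loops and no oriented $2$-cycles (multiple arrows allowed) on the even vertices $x_1,\ldots,x_n$, extra odd vertices $\xi_1,\ldots,\xi_m$ (no arrows among them), and a multiset of ''$2$-paths'' $(\xi_i\to x_k\to\xi_j)$, such that for each $k$ the set $I_k$ of starting indices and the set $J_k$ of ending indices of $2$-paths through $x_k$ are disjoint and every pair $(i,j)\in I_k\times J_k$ is joined by the same number of $2$-paths through $x_k$. The odd variables $\xi_i$ anticommute with each other (so $\xi_i^2=0$) and commute with the even ones. Mutation $\mu_k$ at $x_k$: (0) the quiver $\mathcal{Q}$ mutates classically (for every path $x_i\to x_k\to x_j$ add an arrow $x_i\to x_j$, reverse all arrows at $x_k$, remove oriented $2$-cycles pairwise); (1* ) for every $2$-path $(\xi_i\to x_k\to\xi_j)$ and every arrow $x_k\to x_\ell$ of the original quiver (with multiplicity), add a $2$-path $(\xi_i\to x_\ell\to\xi_j)$; (2* ) each $2$-path $(\xi_i\to x_k\to\xi_j)$ is reversed to $(\xi_j\to x_k\to\xi_i)$; (3* ) $2$-paths $(\xi_i\to x_\ell\to\xi_j)$ and $(\xi_j\to x_\ell\to\xi_i)$ through the same vertex cancel pairwise. In the new extended quiver, the vertex $x_k$ is relabeled $x_k'$. *)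

(* Defs.v *)
From HB Require Import structures.
From mathcomp Require Import all_boot all_order all_algebra.
From mathcomp Require Import ring.
From mathcomp.multinomials Require Import mpoly.

Set Implicit Arguments.
Unset Strict Implicit.
Unset Printing Implicit Defensive.

Import GRing.Theory.
Local Open Scope ring_scope.

(* Even vertices x_i are indexed by 'I_n and odd vertices xi_i by 'I_m.  The
   multisets of arrows and of 2-paths are given by their multiplicities:
   [arr i j] is the number of arrows x_i -> x_j and [tpath k i j] the number of
   2-paths (xi_i -> x_k -> xi_j). *)
Record quiver_data (n m : nat) := QuiverData {
  arr : 'I_n -> 'I_n -> nat;
  tpath : 'I_n -> 'I_m -> 'I_m -> nat
}.

Section ExtendedQuiver.
Variables (n m : nat).
Implicit Types (Q : quiver_data n m) (k : 'I_n).

Definition tstart Q k : {set 'I_m} :=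
  [set i | [exists j, (0 < tpath Q k i j)%N]].
Definition tend Q k : {set 'I_m} :=
  [set j | [exists i, (0 < tpath Q k i j)%N]].

Record extended_quiver Q : Prop := ExtendedQuiver {
  no_loop : forall i, arr Q i i = 0%N;
  no_2cycle : forall i j, (0 < arr Q i j)%N -> arr Q j i = 0%N;
  start_end_disjoint : forall k, [disjoint tstart Q k & tend Q k];
  same_number : forall k, exists c : nat,
    forall i j, i \in tstart Q k -> j \in tend Q k -> tpath Q k i j = c
}.

(* For every path x_i -> x_k -> x_j add an arrow x_i -> x_j, and for every
   2-path (xi_i -> x_k -> xi_j) and every arrow x_k -> x_l add a 2-path
   (xi_i -> x_l -> xi_j). *)
Definition mut_add k Q : quiver_data n m := QuiverData
  (fun i j => arr Q i j + arr Q i k * arr Q k j)%N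
  (fun l i j => tpath Q l i j + tpath Q k i j * arr Q k l)%N.

Definition mut_reverse k Q : quiver_data n m := QuiverData
  (fun i j => if (i == k) || (j == k) then arr Q j i else arr Q i j)
  (fun l i j => if l == k then tpath Q l j i else tpath Q l i j).

(* Pairwise cancellation; the subtractions are truncated. *)
Definition mut_cancel Q : quiver_data n m := QuiverData
  (fun i j => arr Q i j - arr Q j i)%N
  (fun l i j => tpath Q l i j - tpath Q l j i)%N.

Definition mutation k Q : quiver_data n m :=
  mut_cancel (mut_reverse k (mut_add k Q)).

End ExtendedQuiver.

(* The Grassmann algebra on e_0, ..., e_(N-1): the value at S = {i1 < ... < ir}
   is the coefficient of the basis monomial e_S = e_i1 ... e_ir. *)
Definition grassmann (R : Type) (N : nat) : Type := {ffun {set 'I_N} -> R}.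

HB.instance Definition _ (R : comUnitRingType) (N : nat) :=
  GRing.Zmodule.on (grassmann R N).

(* e_S e_T = (-1)^(ninv S T) e_(S :|: T) for disjoint S and T *)
Definition ninv (N : nat) (S T : {set 'I_N}) : nat :=
  \sum_(i in S) \sum_(j in T) (j < i)%N.

Section GrassmannRing.
Variables (R : comUnitRingType) (N : nat).
Local Notation G := (grassmann R N).
Implicit Types (a b c : G) (S T U : {set 'I_N}).

Definition grC (r : R) : G := [ffun S => if S == set0 then r else 0].

Definition gr_gen (i : 'I_N) : G := [ffun S => (S == [set i])%:R].

Definition gr_mul a b : G := [ffun U : {set 'I_N} =>
  \sum_(S : {set 'I_N} | S \subset U)
     (-1) ^+ ninv S (U :\: S) * (a S * b (U :\: S))].

Lemma ninv0l T : ninv set0 T = 0%N.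
Proof. by rewrite /ninv big_set0. Qed.

Lemma ninv0r S : ninv S set0 = 0%N.
Proof. by rewrite /ninv big1 // => i _; rewrite big_set0. Qed.

Lemma ninvDl S S' T : [disjoint S & S'] ->
  ninv (S :|: S') T = (ninv S T + ninv S' T)%N.
Proof.
by move=> dSS'; rewrite /ninv (eq_bigl [predU S & S']) ?bigU // => i; rewrite !inE.
Qed.

Lemma ninvDr S T T' : [disjoint T & T'] ->
  ninv S (T :|: T') = (ninv S T + ninv S T')%N.
Proof.
move=> dTT'; rewrite /ninv -big_split; apply: eq_bigr => i _ /=.
by rewrite (eq_bigl [predU T & T']) ?bigU // => j; rewrite !inE.
Qed.

Lemma gr_mulA : associative gr_mul.
Proof.
move=> a b c; apply/ffunP=> U; rewrite !ffunE.
under eq_bigr => S _ do rewrite ffunE 2!mulr_sumr.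
under [RHS]eq_bigr => W _ do rewrite ffunE mulr_suml mulr_sumr.
rewrite [RHS](exchange_big_dep (fun S => S \subset U)) /=; last first.
  by move=> W S sWU sSW; apply: subset_trans sWU.
apply: eq_bigr => S sSU.
rewrite [RHS](reindex_onto (fun T => S :|: T) (fun W => W :\: S)) /=; last first.
  move=> W /andP[_ sSW]; apply/setP=> x; rewrite !inE.
  by case: (boolP (x \in S)) => //= /(subsetP sSW) ->.
have condE T : (T \subset U :\: S) =
  (S :|: T \subset U) && (S \subset S :|: T) && ((S :|: T) :\: S == T).
  rewrite subsetUl andbT subUset sSU subsetD /=; congr andb.
  rewrite setDUl setDv set0U; apply/idP/eqP; first by move/disjoint_setI0;
    move=> dTS; apply/setDidPl; rewrite -setI_eq0 dTS.
  by move/setDidPl.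
rewrite (eq_bigl _ _ condE); apply: eq_bigr => T.
rewrite -condE subsetD => /andP[sTU dTS].
have -> : (S :|: T) :\: S = T.
  by rewrite setDUl setDv set0U; apply/setDidPl.
rewrite setDDl.
have dST : [disjoint S & T] by rewrite disjoint_sym.
have US : U :\: S = T :|: (U :\: (S :|: T)).
  apply/setP=> x; rewrite !inE.
  have := subsetP sTU x; have := disjointFr dTS (x:=x).
  by case: (x \in T); case: (x \in S); case: (x \in U) => //= H1 H2;
    rewrite ?(H1 isT) ?(H2 isT) //; have := H1 isT.
have dTU : [disjoint T & U :\: (S :|: T)].
  by rewrite -setI_eq0; apply/eqP/setP=> x; rewrite !inE;
     case: (x \in T); rewrite ?orbT.
rewrite {1}US ninvDr // ninvDl // !exprD.
by ring.
Qed.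

Lemma gr_mulCl r a : gr_mul (grC r) a = [ffun S => r * a S].
Proof.
apply/ffunP=> U; rewrite !ffunE (bigD1 set0) ?sub0set //= big1 => [|S /andP[_ nS]].
  by rewrite ffunE eqxx ninv0l expr0 mul1r setD0 addr0.
by rewrite ffunE (negPf nS) mul0r mulr0.
Qed.

Lemma gr_mulCr r a : gr_mul a (grC r) = [ffun S => r * a S].
Proof.
apply/ffunP=> U; rewrite !ffunE (bigD1 U) //= big1 => [|S /andP[sSU nS]].
  by rewrite setDv ffunE eqxx ninv0r expr0 mul1r addr0 mulrC.
rewrite ffunE setD_eq0; case: ifP => [sUS|_]; last by rewrite !mulr0.
by case/eqP: nS; apply/eqP; rewrite eqEsubset sSU.
Qed.

Lemma gr_mul1l : left_id (grC 1) gr_mul.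
Proof. by move=> a; apply/ffunP=> S; rewrite gr_mulCl ffunE mul1r. Qed.

Lemma gr_mul1r : right_id (grC 1) gr_mul.
Proof. by move=> a; apply/ffunP=> S; rewrite gr_mulCr ffunE mul1r. Qed.

Lemma gr_mulDl : left_distributive gr_mul +%R.
Proof.
move=> a b c; apply/ffunP=> U; rewrite !ffunE -big_split.
by apply: eq_bigr => S _; rewrite !ffunE mulrDl mulrDr.
Qed.

Lemma gr_mulDr : right_distributive gr_mul +%R.
Proof.
move=> a b c; apply/ffunP=> U; rewrite !ffunE -big_split.
by apply: eq_bigr => S _; rewrite !ffunE !mulrDr.
Qed.

Lemma gr_oner_neq0 : grC 1 != 0.
Proof.
by apply/eqP=> /ffunP/(_ set0); rewrite !ffunE eqxx; apply/eqP/oner_neq0.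
Qed.

HB.instance Definition _ := GRing.Zmodule_isNzRing.Build (grassmann R N)
  gr_mulA gr_mul1l gr_mul1r gr_mulDl gr_mulDr gr_oner_neq0.

(* The left odd derivation with gr_deriv i (e_j) = (i == j), from
   e_i e_S = (-1)^(ninv [set i] S) e_(i |: S) for i \notin S. *)
Definition gr_deriv (i : 'I_N) a : G := [ffun S : {set 'I_N} =>
  if i \in S then 0 else (-1) ^+ ninv [set i] S * a (i |: S)].

End GrassmannRing.

(* An element is invertible iff its coefficient on e_set0 is; the inverse is
   given by the finite geometric series in its nilpotent part. *)
Section GrassmannUnit.
Variables (R : comUnitRingType) (N : nat).
Local Notation G := (grassmann R N).
Implicit Types (a b : G) (S T U : {set 'I_N}).

Definition gr_unit : pred G := fun a => a set0 \is a GRing.unit.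

Definition gr_inv a : G :=
  if gr_unit a then
    (\sum_(r < N.+1) (1 - grC N (a set0)^-1 * a) ^+ r) * grC N (a set0)^-1
  else a.

Lemma gr_mul0E a b : (a * b) set0 = a set0 * b set0.
Proof.
rewrite ffunE (bigD1 set0) //= big1 => [|S]; last by rewrite subset0 => /andP[->].
by rewrite ninv0l setD0 expr0 mul1r addr0.
Qed.

Lemma gr_1E : (1 : G) set0 = 1.
Proof. by rewrite [LHS](ffunE (fun S => if S == set0 then 1 else 0)) eqxx. Qed.

Lemma grCM r s : grC N (r * s) = grC N r * grC N s :> G.
Proof.
have -> : grC N r * grC N s = gr_mul (grC N r) (grC N s) by [].
by apply/ffunP=> S; rewrite gr_mulCl !ffunE; case: ifP; rewrite ?mulr0.
Qed.

Lemma grC_comm r a : grC N r * a = a * grC N r.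
Proof. exact: etrans (gr_mulCl r a) (esym (gr_mulCr r a)). Qed.

Lemma gr_nilp a r S : a set0 = 0 -> (#|S| < r)%N -> (a ^+ r) S = 0.
Proof.
move=> a0; elim: r S => [//|r IHr] S ltSr; rewrite exprS ffunE big1 // => T sTS.
have [->|T0] := eqVneq T set0; first by rewrite a0 mul0r mulr0.
rewrite IHr ?mulr0 // cardsDS // -subSn ?subset_leq_card //.
by rewrite leq_subLR (leq_trans ltSr) // -add1n leq_add2r card_gt0.
Qed.

Lemma gr_geom a : gr_unit a ->
  let u := 1 - grC N (a set0)^-1 * a in
  (\sum_(r < N.+1) u ^+ r) * (1 - u) = 1 /\ (1 - u) * (\sum_(r < N.+1) u ^+ r) = 1.
Proof.
move=> Ua u.
have u0 : u ^+ N.+1 = 0.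
  have uE : u set0 = 0.
    have -> : u set0 = (1 : G) set0 - (grC N (a set0)^-1 * a) set0.
      by rewrite ffunE; congr (_ + _); rewrite [LHS]ffunE.
    by rewrite gr_1E gr_mul0E ffunE eqxx mulVr // subrr.
  apply/ffunP=> S; rewrite [RHS]ffunE; apply: gr_nilp => //.
  by rewrite ltnS -[leqRHS]card_ord max_card.
have E : (1 - u) * (\sum_(r < N.+1) u ^+ r) = 1.
  have := subrXX_comm N.+1 (commr_sym (commr1 u)); rewrite u0 expr1n subr0 => E1.
  rewrite [RHS]E1.
  by congr (_ * _); apply: eq_bigr => i _; rewrite expr1n mul1r.
split=> //; rewrite -[RHS]E; apply: commr_sym.
apply: commr_sum => i _; apply: commrX; apply: commr_sym.
by apply: commrB; [exact: commr1|].
Qed.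

Lemma gr_invE a : gr_unit a -> gr_inv a =
  (\sum_(r < N.+1) (1 - grC N (a set0)^-1 * a) ^+ r) * grC N (a set0)^-1.
Proof. by rewrite /gr_inv => ->. Qed.

Lemma gr_mulVr : {in gr_unit, left_inverse 1 gr_inv *%R}.
Proof.
move=> a Ua; rewrite gr_invE //.
have [+ _] := gr_geom Ua; rewrite opprB addrCA subrr addr0 => E.
by rewrite -mulrA.
Qed.

Lemma gr_divrr : {in gr_unit, right_inverse 1 gr_inv *%R}.
Proof.
move=> a Ua; rewrite gr_invE //.
have [_] := gr_geom Ua; rewrite opprB addrCA subrr addr0 => E.
by rewrite mulrA -grC_comm mulrA.
Qed.

Lemma gr_unitP a b : b * a = 1 /\ a * b = 1 -> gr_unit a.
Proof.
case=> ba ab; apply/unitrP; exists (b set0).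
by rewrite -!gr_mul0E ba ab gr_1E.
Qed.

Lemma gr_inv_out : {in [predC gr_unit], gr_inv =1 id}.
Proof.
by move=> a /negPf Ua; rewrite /gr_inv (Ua : gr_unit a = false).
Qed.

HB.instance Definition _ := GRing.NzRing_hasMulInverse.Build (grassmann R N)
  gr_mulVr gr_divrr gr_unitP gr_inv_out.

End GrassmannUnit.

Section Forms.
Variables (F : fieldType) (n m : nat).

Definition ratfun : fieldType := {fraction {mpoly F[n]}}.

(* D (p / q) = (D p * q - p * D q) / q ^ 2, for the partial derivative D with
   respect to the i-th variable *)
Definition ratfun_deriv (i : 'I_n) (f : ratfun) : ratfun :=
  let p := (frac (repr f)).1 in
  let q := (frac (repr f)).2 in
  tofrac (mderiv i p * q - p * mderiv i q) / tofrac (q ^+ 2).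

(* The algebra of differential forms whose coefficients are the superfunctions
   F(x_1, ..., x_n)[xi_1, ..., xi_m], with the wedge product as its
   multiplication.  Signs are governed by the total parity (parity of the
   function plus degree of the form): the xi_j and the dx_i are odd, the x_i and
   the dxi_j are even.  The dxi_j are the variables 'X_j of the polynomial ring
   of coefficients of the Grassmann algebra; the Grassmann generators are first
   the xi_j and then the dx_i. *)
Definition forms : unitRingType := grassmann {mpoly ratfun[m]} (m + n).

Definition xvar (i : 'I_n) : forms :=
  grC (m + n) (mpolyC m (tofrac 'X_i : ratfun)).
Definition xivar (j : 'I_m) : forms := gr_gen {mpoly ratfun[m]} (lshift n j).
Definition dxvar (i : 'I_n) : forms := gr_gen {mpoly ratfun[m]} (rshift m i).
Definition dxivar (j : 'I_m) : forms := grC (m + n) ('X_j : {mpoly ratfun[m]}).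

Definition form_partial (i : 'I_n) (w : forms) : forms :=
  [ffun S => map_mpoly (ratfun_deriv i) ((w : grassmann _ _) S)].

(* The de Rham differential, an odd derivation:
   d = \sum_i dx_i * d/dx_i + \sum_j dxi_j * d/dxi_j *)
Definition dform (w : forms) : forms :=
  \sum_(i < n) dxvar i * form_partial i w +
  \sum_(j < m) dxivar j * gr_deriv (lshift n j) w.

(* The 2-form of an extended quiver whose even vertices carry the labels X i. *)
Definition omega (Q : quiver_data n m) (X : 'I_n -> forms) : forms :=
  \sum_(i < n) \sum_(j < n)
     (dform (X i) * dform (X j) / (X i * X j)) *+ arr Q i j +
  \sum_(l < n) \sum_(i < m) \sum_(j < m)
     (dform (xivar i * xivar j) * dform (X l) / X l) *+ tpath Q l i j.

(* The right-hand side of the exchange relation at x_k. *)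
Definition exchange (Q : quiver_data n m) (k : 'I_n) (X : 'I_n -> forms)
    : forms :=
  \prod_(j < n) X j ^+ arr Q k j +
  (1 + \sum_(i < m) \sum_(j < m) (xivar i * xivar j) *+ tpath Q k i j) *
  \prod_(i < n) X i ^+ arr Q i k.

End Forms.

(* Main.v *)
Require Import Defs.
From HB Require Import structures.
From mathcomp Require Import all_boot all_order all_algebra.
From mathcomp Require Import ring.
From mathcomp.multinomials Require Import mpoly.
Set Implicit Arguments.
Unset Strict Implicit.
Unset Printing Implicit Defensive.
Import GRing.Theory.
Local Open Scope ring_scope.

(* Mutation acts on omega as a change of logarithmic forms.  Write L_i = dx_i/x_i,
   P and M for the products over the arrows leaving and entering x_k, theta for
   the sum of the xi_i xi_j over the 2-paths through x_k, p = dP/P and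
   q = dM/M + d theta.  The combinatorial mutation amounts to adding the single
   product q p and replacing L_k by its opposite (cancellation changes nothing,
   by antisymmetry).  Substituting x_k = E/x_k', E = P + (1 + theta) M, also
   replaces L_k by its opposite but shifted by D = dE/E, which changes omega by
   q D + D p.  Since theta d theta = 0, dE = P p + (1 + theta) M q, and since
   p and q are odd, q dE + dE p = E q p, i.e. q D + D p = q p. *)

(** * Derivations of rational functions *)

Lemma tofrac_numden (R : idomainType) (f : {fraction R}) :
  f = tofrac (frac (repr f)).1 / tofrac (frac (repr f)).2.
Proof.
have d0 := denom_ratioP (repr f).
apply: (mulIf (_ : tofrac (frac (repr f)).2 != 0)); first by rewrite tofrac_eq0.
rewrite divfK ?tofrac_eq0 // -{1}[f]reprK; unlock FracField.tofrac.
rewrite -[LHS]FracField.pi_mul /FracField.mulf !numden_Ratio ?oner_eq0 // mulr1.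
apply/eqmodP; rewrite /= FracField.equivfE !numden_Ratio ?oner_eq0 //.
by rewrite mulr1 mulrC.
Qed.

Section RationalDerivation.
Variables (F : fieldType) (n : nat).
Local Notation K := (ratfun F n).
Implicit Types (p q : {mpoly F[n]}) (f g : K).

(** [ratfun_deriv] is computed on a chosen representative a / b. Differentiating p b = a q shows
    that any other representative p / q gives the same result. *)
Lemma ratfun_deriv_frac i p q : q != 0 ->
  ratfun_deriv i (tofrac p / tofrac q : K) =
  tofrac (mderiv i p * q - p * mderiv i q) / tofrac (q ^+ 2).
Proof.
move=> q0; rewrite /ratfun_deriv; set f : K := _ / tofrac q.
have d0 := denom_ratioP (repr f).
have := tofrac_numden f; rewrite {1}/f => /eqP.
set a := (frac (repr f)).1; set b := (frac (repr f)).2.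
rewrite eqr_div ?tofrac_eq0 // -!tofracM tofrac_eq => /eqP E.
have dE : mderiv i p * b + p * mderiv i b = mderiv i a * q + a * mderiv i q.
  by rewrite -!mderivM E.
apply/eqP; rewrite eqr_div ?tofrac_eq0 ?expf_neq0 // -!tofracM tofrac_eq; apply/eqP.
(* The regroupings expose [mderiv i a * q], eliminated by [dE], and [a * q], eliminated by [E]. *)
have -> : (mderiv i a * b - a * mderiv i b) * q ^+ 2 =
  (mderiv i a * q) * b * q - (a * q) * mderiv i b * q by ring.
have -> : mderiv i a * q = mderiv i p * b + p * mderiv i b - a * mderiv i q.
  by rewrite dE addrK.
have -> : (mderiv i p * b + p * mderiv i b - a * mderiv i q) * b * q =
  (mderiv i p * b + p * mderiv i b) * b * q - (a * q) * b * mderiv i q by ring.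
by rewrite -E; ring.
Qed.

Lemma ratfun_derivB i : zmod_morphism (@ratfun_deriv F n i).
Proof.
move=> f g; rewrite (tofrac_numden f) (tofrac_numden g).
have := denom_ratioP (repr f); have := denom_ratioP (repr g).
move: (frac (repr f)).1 (frac (repr f)).2 (frac (repr g)).1 (frac (repr g)).2.
move=> p q r s s0 q0.
have -> : (tofrac p / tofrac q - tofrac r / tofrac s : K) =
  tofrac (p * s - r * q) / tofrac (q * s).
  by rewrite -mulNr addf_div ?tofrac_eq0 // -rmorphN -!rmorphM -rmorphD mulNr.
rewrite !ratfun_deriv_frac ?mulf_neq0 // -[X in _ = _ + X]mulNr
  addf_div ?tofrac_eq0 ?expf_neq0 //.
rewrite -rmorphN -!rmorphM -rmorphD exprMn; congr (tofrac _ / _).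
by rewrite mderivB !mderivM; ring.
Qed.

HB.instance Definition _ i := GRing.isZmodMorphism.Build K K (@ratfun_deriv F n i)
  (ratfun_derivB i).

Lemma ratfun_derivM i f g :
  ratfun_deriv i (f * g) = ratfun_deriv i f * g + f * ratfun_deriv i g.
Proof.
rewrite (tofrac_numden f) (tofrac_numden g).
have := denom_ratioP (repr f); have := denom_ratioP (repr g).
move: (frac (repr f)).1 (frac (repr f)).2 (frac (repr g)).1 (frac (repr g)).2.
move=> p q r s s0 q0.
rewrite mulf_div -!rmorphM !ratfun_deriv_frac ?mulf_neq0 // !mulf_div.
rewrite -!rmorphM addf_div ?tofrac_eq0 ?mulf_neq0 ?expf_neq0 //.
rewrite -!rmorphM -rmorphD; apply/eqP.
rewrite eqr_div ?tofrac_eq0 ?mulf_neq0 ?expf_neq0 ?mulf_neq0 //.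
rewrite -!tofracM tofrac_eq; apply/eqP.
by rewrite !mderivM; ring.
Qed.

End RationalDerivation.

(** * Parity in Grassmann algebras *)

Section Parity.
Variables (R : comUnitRingType) (N : nat).
Local Notation G := (grassmann R N).
Implicit Types (a b : G) (S T U : {set 'I_N}).

Definition gr_parity (e : bool) : {pred G} :=
  fun a => [forall S : {set 'I_N}, (odd #|S| != e) ==> (a S == 0)].

Lemma gr_parityP e a :
  reflect (forall S, odd #|S| != e -> a S = 0) (a \in gr_parity e).
Proof.
apply: (iffP forallP) => [ha S hS|ha S]; first by apply/eqP; apply: (implyP (ha S)).
by apply/implyP=> /ha->.
Qed.

Lemma gr_mulE a b U : (a * b) U = \sum_(S : {set 'I_N} | S \subset U)
  (-1) ^+ ninv S (U :\: S) * (a S * b (U :\: S)).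
Proof. exact: ffunE. Qed.

Lemma gr_subE a b S : (a - b) S = a S - b S.
Proof. by rewrite [LHS]ffunE [X in _ + X]ffunE. Qed.

Lemma grC_mulE r a S : (grC N r * a) S = r * a S.
Proof.
exact: etrans (congr1 (fun f : {ffun _ -> R} => f S) (gr_mulCl r a)) (ffunE _ S).
Qed.

Lemma gr_parity_zmod_closed e : zmod_closed (gr_parity e).
Proof.
split=> [|a b /gr_parityP ha /gr_parityP hb]; apply/gr_parityP=> S hS.
  by rewrite ffunE.
by rewrite !ffunE ha // hb // subrr.
Qed.

HB.instance Definition _ e := GRing.isZmodClosed.Build G (gr_parity e)
  (gr_parity_zmod_closed e).

Lemma gr_parity_grC r : grC N r \in gr_parity false.
Proof.
by apply/gr_parityP=> S; rewrite ffunE; case: (S =P _) => // ->; rewrite cards0.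
Qed.

Lemma gr_parity_gen i : gr_gen R i \in gr_parity true.
Proof.
by apply/gr_parityP=> S; rewrite ffunE; case: (S =P _) => // ->; rewrite cards1.
Qed.

Lemma card_sub_odd S U : S \subset U -> odd #|U| = odd #|S| (+) odd #|U :\: S|.
Proof. by move=> sSU; rewrite -oddD cardsDS // subnKC // subset_leq_card. Qed.

Lemma gr_parityM e f a b : a \in gr_parity e -> b \in gr_parity f ->
  a * b \in gr_parity (e (+) f).
Proof.
move=> /gr_parityP ha /gr_parityP hb; apply/gr_parityP=> U hU.
rewrite gr_mulE big1 // => S sSU.
have := hU; rewrite (card_sub_odd sSU).
have [<- | /ha->] := eqVneq (odd #|S|) e; last by rewrite mul0r mulr0.
by rewrite (inj_eq (@addbI _)) => /hb->; rewrite !mulr0.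
Qed.

(** Each pair (i, j) is an inversion in exactly one of the two orders, since disjointness excludes i
    = j. *)
Lemma ninvC S T : [disjoint S & T] -> (ninv S T + ninv T S = #|S| * #|T|)%N.
Proof.
move=> dST; rewrite /ninv [X in (_ + X)%N]exchange_big /= -big_split /=.
rewrite -sum_nat_const; apply: eq_bigr => i iS.
rewrite -big_split -sum1_card; apply: eq_bigr => j jT /=.
by case: ltngtP => // /val_inj ij; rewrite ij (disjointFr dST iS) in jT.
Qed.

(** Complementation in U matches the terms of both products, and by [ninvC] the signs of matching
    terms differ by the parity of [#|S| * #|T|]. Only S and T in the supports matter, which covers
    both commutation rules below. *)
Lemma gr_mul_sign a b (e : nat) :
    (forall S T, a S != 0 -> b T != 0 -> odd (#|S| * #|T|) = odd e) ->
  a * b = (-1) ^+ e * (b * a).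
Proof.
move=> hab; apply/ffunP=> U.
have -> : ((-1) ^+ e * (b * a)) U = (-1) ^+ e * (b * a) U.
  rewrite -[in LHS]signr_odd -[in RHS]signr_odd; case: (odd e) => /=.
    rewrite !expr1 !mulN1r. exact: ffunE.
  by rewrite !expr0 !mul1r.
rewrite (gr_mulE a b U) (gr_mulE b a U).
rewrite mulr_sumr.
rewrite [RHS](reindex_onto (fun S => U :\: S) (fun S => U :\: S)) /=; last first.
  by move=> S sSU; rewrite setDDr setDv set0U; apply/setIidPr.
have cE S : (U :\: S \subset U) && (U :\: (U :\: S) == S) = (S \subset U).
  by rewrite subsetDl setDDr setDv set0U; apply/eqP/idP => /setIidPr.
rewrite [RHS](eq_bigl _ _ cE); apply: eq_bigr => S sSU.
have -> : U :\: (U :\: S) = S by rewrite setDDr setDv set0U; apply/setIidPr.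
have [->|aS] := eqVneq (a S) 0; first by rewrite mul0r !mulr0.
have [->|bT] := eqVneq (b (U :\: S)) 0; first by rewrite mul0r !mulr0.
rewrite mulrA -exprD [a S * _]mulrC; congr (_ * _).
rewrite -[LHS]signr_odd -[RHS]signr_odd oddD -(hab _ _ aS bT) -ninvC; last first.
  by rewrite -setI_eq0 setIDA setIC -setIDA setDv setI0.
by rewrite oddD addbK.
Qed.

Lemma gr_even_comm a b : a \in gr_parity false -> a * b = b * a.
Proof.
move=> /gr_parityP ha; rewrite (gr_mul_sign (e := 0)) ?mul1r // => S T aS _.
by rewrite oddM; case: (boolP (odd #|S|)) => // h; rewrite ha ?h ?eqxx in aS.
Qed.

Lemma gr_odd_anticomm a b : a \in gr_parity true -> b \in gr_parity true ->
  a * b = - (b * a).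
Proof.
move=> /gr_parityP ha /gr_parityP hb.
rewrite (gr_mul_sign (e := 1)) ?mulN1r // => S T aS bT; rewrite oddM.
case: (boolP (odd #|S|)) => [_|h]; last by rewrite ha ?(negPf h) ?eqxx in aS.
by case: (boolP (odd #|T|)) => // h; rewrite hb ?(negPf h) ?eqxx in bT.
Qed.

Lemma gr_gen_mulE i a U : (gr_gen R i * a) U =
  if i \in U then (-1) ^+ ninv [set i] (U :\ i) * a (U :\ i) else 0.
Proof.
rewrite gr_mulE; case: ifP => iU.
  rewrite (bigD1 [set i]) ?sub1set //= big1 => [|S /andP[_ /negPf nS]].
    by rewrite ffunE eqxx mul1r addr0.
  by rewrite ffunE nS mul0r mulr0.
rewrite big1 // => S sSU; rewrite ffunE; case: eqP => [Si|_].
  by rewrite Si sub1set iU in sSU.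
by rewrite mul0r mulr0.
Qed.

(** * Odd derivations along the generators *)

Lemma gr_deriv_is_zmod_morphism i : zmod_morphism (@gr_deriv R N i).
Proof.
move=> a b; apply/ffunP=> S; rewrite !ffunE; case: ifP => _; first by rewrite subrr.
by rewrite mulrBr.
Qed.

HB.instance Definition _ i := GRing.isZmodMorphism.Build G G (@gr_deriv R N i)
  (gr_deriv_is_zmod_morphism i).

Lemma gr_derivZ i r a : gr_deriv i (grC N r * a) = grC N r * gr_deriv i a.
Proof.
apply/ffunP=> S; rewrite grC_mulE /gr_deriv !(ffunE _ S) grC_mulE.
by case: ifP; rewrite ?mulr0 // mulrCA.
Qed.

Lemma ninv11 (i j : 'I_N) : i != j ->
  (ninv [set i] [set j] + ninv [set j] [set i] = 1)%N.
Proof.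
by move=> ij; rewrite ninvC ?cards1 //; rewrite disjoints1 inE.
Qed.

Lemma gr_deriv_genM i j a : gr_deriv i (gr_gen R j * a) =
  a *+ (i == j) - gr_gen R j * gr_deriv i a.
Proof.
apply/ffunP=> S; rewrite ffunE gr_gen_mulE.
rewrite [RHS]ffunE [X in _ + X]ffunE gr_gen_mulE /gr_deriv ffunE.
have [<-{j}|ij] := eqVneq i j; rewrite !inE.
  rewrite eqxx /=; case: ifP => iS.
    by rewrite mulr1n setD1K // mulrA -exprD addnn -signr_odd odd_double mul1r subrr.
  by rewrite mulr1n subr0 setU1K ?iS // mulrA -exprD addnn -signr_odd odd_double mul1r.
rewrite mulr0n ffunE add0r [j == i]eq_sym (negPf ij) /=.
case: (boolP (i \in S)) => iS; first by case: ifP; rewrite ?mulr0 oppr0.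
case: ifP => jS; last by rewrite mulr0 oppr0.
have -> : (i |: S) :\ j = i |: (S :\ j).
  by apply/setP=> l; rewrite !inE; have [->|] := eqVneq l i; rewrite ?ij.
rewrite !mulrA -!exprD -mulNr; congr (_ * _).
have dU l : [disjoint [set l] & S :\ l] by rewrite disjoints1 !inE eqxx.
rewrite -{1}(setD1K jS) ninvDr ?dU // [ninv [set j] _]ninvDr; last first.
  by rewrite disjoints1 !inE (negPf iS) andbF.
(* Deriving by i and multiplying by j in the two orders differ by the single inversion between i and
   j, hence the minus sign. *)
rewrite addnACA ninv11 // exprD expr1 mulN1r; congr (- (-1) ^+ _).
exact: addnC.
Qed.

Lemma gr_deriv1 i : gr_deriv i (1 : G) = 0.
Proof.
have -> : (1 : G) = grC N 1 by [].
apply/ffunP=> S; rewrite !ffunE; case: ifP => // _.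
by case: eqP => [/setP/(_ i)|]; rewrite ?mulr0 // !inE eqxx.
Qed.

Lemma grC_is_zmod_morphism : zmod_morphism (@grC R N).
Proof.
move=> r s; apply/ffunP=> S; rewrite gr_subE !(ffunE _ S).
by case: ifP; rewrite ?subr0.
Qed.

Lemma grC_is_monoid_morphism : monoid_morphism (@grC R N).
Proof. by split=> [|r s]; rewrite ?grCM. Qed.

HB.instance Definition _ := GRing.isZmodMorphism.Build R G (@grC R N)
  grC_is_zmod_morphism.
HB.instance Definition _ := GRing.isMonoidMorphism.Build R G (@grC R N)
  grC_is_monoid_morphism.

(** * Coefficientwise maps *)

Definition gr_map (f : R -> R) a : G := [ffun S => f (a S)].

Lemma gr_map_is_zmod_morphism (f : {additive R -> R}) :
  zmod_morphism (gr_map f).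
Proof.
have mapE a S : gr_map f a S = f (a S) by exact: ffunE.
by move=> a b; apply/ffunP=> S; rewrite gr_subE !mapE gr_subE raddfB.
Qed.

(** Integer coefficients pass through any additive map, so a scalar times a monomial in the
    generators can be handled by additivity alone. *)
Definition int_coef a := forall S, exists z : int, a S = z%:~R.

Lemma gr_map_grCM (f : {additive R -> R}) r a : int_coef a ->
  gr_map f (grC N r * a) = grC N (f r) * a.
Proof.
move=> az; apply/ffunP=> S; rewrite (ffunE _ S) !grC_mulE.
by have [z ->] := az S; rewrite !mulrzr raddfMz.
Qed.

Lemma int_coef1 : int_coef 1.
Proof.
move=> S; exists (S == set0)%:R.
by rewrite (ffunE _ S); case: (S == _).
Qed.

Lemma int_coefM a b : int_coef a -> int_coef b -> int_coef (a * b).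
Proof.
move=> az bz S; rewrite gr_mulE.
elim/big_ind: _ => [|_ _ [z ->] [z' ->]|T _]; first by exists 0.
  by exists (z + z'); rewrite rmorphD.
have [z ->] := az T; have [z' ->] := bz (S :\: T).
exists ((-1) ^+ ninv T (S :\: T) * (z * z')).
by rewrite !rmorphM /= rmorphXn /= rmorphN1.
Qed.

Lemma int_coef_gen i : int_coef (gr_gen R i).
Proof. by move=> S; exists (S == [set i])%:R; rewrite (ffunE _ S); case: eqP. Qed.

End Parity.

(** * The differential *)

Section Differential.
Variables (K : fieldType) (R : comUnitRingType) (c : {rmorphism K -> R}).
Variables (m n : nat) (del : 'I_n -> {additive K -> K}).
Variables (f : 'I_n -> {additive R -> R}) (y : 'I_m -> R).
Hypothesis delM : forall i r s, del i (r * s) = del i r * s + r * del i s.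
Hypothesis fE : forall i r, f i (c r) = c (del i r).
Local Notation G := (grassmann R (m + n)).
Implicit Types (r s : K) (w : G).

Definition cst r : G := grC (m + n) (c r).
Definition xi (j : 'I_m) : G := gr_gen R (lshift n j).
Definition dx (i : 'I_n) : G := gr_gen R (rshift m i).
Definition dxi (j : 'I_m) : G := grC (m + n) (y j).

(** [dform] over abstract coefficients: [c] embeds the functions of the x_i into [R], [f i] extends
    the derivation [del i] to [R], and [y j] stands for dxi_j. *)
Definition gr_diff w : G :=
  \sum_(i < n) dx i * gr_map (f i) w +
  \sum_(j < m) dxi j * gr_deriv (lshift n j) w.

Lemma gr_diff_is_zmod_morphism : zmod_morphism gr_diff.
Proof.
move=> w w'; rewrite /gr_diff opprD addrACA -!sumrB.
congr (_ + _); apply: eq_bigr => i _.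
  by rewrite gr_map_is_zmod_morphism mulrBr.
by rewrite -mulrBr -raddfB.
Qed.

HB.instance Definition _ := GRing.isZmodMorphism.Build G G gr_diff
  gr_diff_is_zmod_morphism.

Lemma cst_is_zmod_morphism : zmod_morphism cst.
Proof. by move=> r s; rewrite /cst !raddfB. Qed.

Lemma cst_is_monoid_morphism : monoid_morphism cst.
Proof.
split=> [|r s]; rewrite /cst; first by rewrite !rmorph1.
by rewrite !rmorphM.
Qed.

HB.instance Definition _ := GRing.isZmodMorphism.Build K G cst
  cst_is_zmod_morphism.
HB.instance Definition _ := GRing.isMonoidMorphism.Build K G cst
  cst_is_monoid_morphism.

Lemma cst_comm r w : cst r * w = w * cst r.
Proof. exact: gr_even_comm (gr_parity_grC _ _). Qed.

Lemma dxi_comm j w : dxi j * w = w * dxi j.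
Proof. exact: gr_even_comm (gr_parity_grC _ _). Qed.

Lemma gr_map_cstM i r w : int_coef w ->
  gr_map (f i) (cst r * w) = cst (del i r) * w.
Proof. by move=> wz; rewrite gr_map_grCM // fE. Qed.

Lemma del1 i : del i 1 = 0.
Proof.
have := delM i 1 1; rewrite !mulr1 mul1r -[LHS]addr0.
by move/addrI=> <-.
Qed.

(** Here w is the constant 1 times w, and a derivation kills 1. *)
Lemma gr_map_int i w : int_coef w -> gr_map (f i) w = 0.
Proof.
move=> wz; rewrite -[w]mul1r -(rmorph1 cst) gr_map_cstM //.
by rewrite del1 rmorph0 mul0r.
Qed.

Lemma gr_diff_cst r : gr_diff (cst r) = \sum_(i < n) dx i * cst (del i r).
Proof.
rewrite /gr_diff -[cst r]mulr1 [X in _ + X]big1 ?addr0 => [|j _].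
  apply: eq_bigr => i _; rewrite gr_map_cstM ?mulr1 //; exact: int_coef1.
by rewrite gr_derivZ gr_deriv1 !mulr0.
Qed.

(** The dx part of the differential sees only [r] and the dxi part only [w], so no cross terms
    arise. *)
Lemma gr_diff_cstMl r w : int_coef w ->
  gr_diff (cst r * w) = gr_diff (cst r) * w + cst r * gr_diff w.
Proof.
move=> wz; rewrite gr_diff_cst /gr_diff mulrDr addrA; congr (_ + _).
  rewrite [X in _ + cst r * X]big1 ?mulr0 ?addr0 => [|i _]; last first.
    by rewrite gr_map_int ?mulr0.
  by rewrite mulr_suml; apply: eq_bigr => i _; rewrite gr_map_cstM ?mulrA.
rewrite mulr_sumr; apply: eq_bigr => j _.
by rewrite gr_derivZ -/(cst r) mulrA -cst_comm mulrA.
Qed.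

Lemma gr_diff_cstM r s :
  gr_diff (cst (r * s)) = gr_diff (cst r) * cst s + cst r * gr_diff (cst s).
Proof.
rewrite !gr_diff_cst mulr_suml mulr_sumr -big_split; apply: eq_bigr => i _ /=.
rewrite delM rmorphD !rmorphM mulrDr !mulrA; congr (_ + _).
by rewrite cst_comm.
Qed.

Lemma gr_diff_cst_odd r : gr_diff (cst r) \in @gr_parity R (m + n) true.
Proof.
rewrite gr_diff_cst rpred_sum // => i _.
apply: (@gr_parityM _ _ true false); [exact: gr_parity_gen | exact: gr_parity_grC].
Qed.

Lemma int_coef_xi2 i j : int_coef (xi i * xi j).
Proof. by apply: int_coefM; exact: int_coef_gen. Qed.

Lemma gr_diff_xi2 i j : gr_diff (xi i * xi j) = dxi i * xi j - dxi j * xi i.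
Proof.
rewrite /gr_diff big1 ?add0r => [|l _]; last first.
  by rewrite gr_map_int ?mulr0 //; exact: int_coef_xi2.
have derE l : gr_deriv (lshift n l) (xi i * xi j) = xi j *+ (l == i) - xi i *+ (l == j).
  rewrite gr_deriv_genM -[X in gr_deriv _ X]mulr1 gr_deriv_genM gr_deriv1 mulr0.
  by rewrite subr0 !(inj_eq (@lshift_inj m n)) mulr_natr.
under eq_bigr => l _ do rewrite derE mulrBr.
rewrite sumrB; congr (_ - _).
  rewrite (bigD1 i) //= eqxx big1 ?addr0 // => l /negPf->.
  by rewrite mulr0n mulr0.
rewrite (bigD1 j) //= eqxx big1 ?addr0 // => l /negPf->.
by rewrite mulr0n mulr0.
Qed.

Lemma xi2C i j : xi i * xi j = - (xi j * xi i).
Proof. by apply: gr_odd_anticomm; exact: gr_parity_gen. Qed.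

Lemma xi2_comm i j w : xi i * xi j * w = w * (xi i * xi j).
Proof.
apply: gr_even_comm.
by apply: (@gr_parityM _ _ true true); exact: gr_parity_gen.
Qed.

Lemma gr_diff_xi2_odd i j : gr_diff (xi i * xi j) \in @gr_parity R (m + n) true.
Proof.
rewrite gr_diff_xi2 rpredB //; apply: (@gr_parityM _ _ false true);
  by [exact: gr_parity_grC | exact: gr_parity_gen].
Qed.

(** Twice w is zero and 2 is invertible. Antisymmetry thereby yields vanishing, such as that of the
    square of an odd form. *)
Lemma gr_self_opp0 : (2 : K) != 0 -> forall w, w = - w -> w = 0.
Proof.
move=> two0 w ww.
have U : cst 2 \is a GRing.unit by apply: rmorph_unit; rewrite unitfE.
apply: (mulrI U); rewrite mulr0 rmorph_nat mulr_natl mulr2n {1}ww.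
exact: addNr.
Qed.

End Differential.

(** * Mutation of logarithmic forms *)

Section QuiverForm.
Variables (W : nzRingType) (n m : nat).
Hypothesis self_opp0 : forall w : W, w = - w -> w = 0.
Implicit Types (Q : quiver_data n m) (L : 'I_n -> W).

Lemma antisym_sum0 (p : nat) (s : 'I_p -> 'I_p -> nat) (f : 'I_p -> 'I_p -> W) :
    (forall i j, s i j = s j i) -> (forall i j, f i j = - f j i) ->
  \sum_i \sum_j f i j *+ s i j = 0.
Proof.
move=> sC fC; apply: self_opp0; rewrite {1}exchange_big /= -sumrN.
apply: eq_bigr => i _; rewrite -sumrN; apply: eq_bigr => j _.
by rewrite sC fC mulNrn.
Qed.

(** Truncated subtraction removes [minn (s i j) (s j i)] from both entries. That amount is symmetric
    and pairs to zero with an antisymmetric family. *)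
Lemma antisym_sum_cancel (p : nat) (s : 'I_p -> 'I_p -> nat)
    (f : 'I_p -> 'I_p -> W) : (forall i j, f i j = - f j i) ->
  \sum_i \sum_j f i j *+ (s i j - s j i)%N = \sum_i \sum_j f i j *+ s i j.
Proof.
move=> fC; apply/eqP; rewrite eq_sym -subr_eq0 -sumrB; apply/eqP.
rewrite -[RHS](antisym_sum0 (s := fun i j => minn (s i j) (s j i)) _ fC); last first.
  by move=> i j; rewrite minnC.
apply: eq_bigr => i _; rewrite -sumrB; apply: eq_bigr => j _.
have {1}<- : (s i j - s j i + minn (s i j) (s j i) = s i j)%N.
  by rewrite minnE subnKC // leq_subr.
by rewrite mulrnDr addrAC subrr add0r.
Qed.

Variable tau : 'I_m -> 'I_m -> W.
Hypothesis tauC : forall i j, tau i j = - tau j i.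

(** [L i] stands for dx_i/x_i and [tau i j] for d(xi_i xi_j). *)
Definition logform Q L : W :=
  \sum_(i < n) \sum_(j < n) (L i * L j) *+ arr Q i j +
  \sum_(l < n) \sum_(i < m) \sum_(j < m) (tau i j * L l) *+ tpath Q l i j.

Definition anticomm_family L := forall i j, L i * L j = - (L j * L i).

Lemma logform_cancel Q L : anticomm_family L ->
  logform (mut_cancel Q) L = logform Q L.
Proof.
move=> LC; congr (_ + _); first exact: antisym_sum_cancel.
apply: eq_bigr => l _.
apply: (antisym_sum_cancel (fun i j => tpath Q l i j)) => i j.
by rewrite tauC mulNr.
Qed.

Definition neg_at (k : 'I_n) L (i : 'I_n) : W := if i == k then - L i else L i.

(** Transposing the multiplicities at k costs a sign, by antisymmetry of the products of the L_i and
    of [tau]. That sign is absorbed by L_k, which occurs once in each affected term other than L_k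
    L_k = 0. *)
Lemma logform_reverse k Q L : anticomm_family L ->
  logform (mut_reverse k Q) L = logform Q (neg_at k L).
Proof.
move=> LC; rewrite /logform /neg_at /=; congr (_ + _).
  pose a i j := (i == k) || (j == k).
  transitivity (\sum_i \sum_(j | a i j) (L i * L j) *+ arr Q j i +
                \sum_i \sum_(j | ~~ a i j) (L i * L j) *+ arr Q i j).
    rewrite -big_split; apply: eq_bigr => i _ /=.
    rewrite (bigID (a i)) /=; congr (_ + _); apply: eq_bigr => j; rewrite /a.
      by move->.
    by move/negPf->.
  have -> : \sum_i \sum_(j | a i j) (L i * L j) *+ arr Q j i =
            - (\sum_i \sum_(j | a i j) (L i * L j) *+ arr Q i j).
    under eq_bigr => i _ do rewrite big_mkcond /=.
    rewrite exchange_big -sumrN /=; apply: eq_bigr => i _.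
    rewrite [in RHS]big_mkcond -sumrN /=; apply: eq_bigr => j _.
    rewrite /a orbC; case: ifP => _; last by rewrite oppr0.
    by rewrite LC mulNrn.
  rewrite -sumrN -big_split; apply: eq_bigr => i _ /=.
  rewrite [RHS](bigID (a i)) /= -sumrN; congr (_ + _); apply: eq_bigr => j.
    rewrite /a; have [->|_] := eqVneq i k; have [->|_] := eqVneq j k => //= _.
    - have -> : L k * L k = 0 by apply/self_opp0/LC.
      by rewrite mulrNN mul0rn oppr0 (self_opp0 (LC k k)) mul0rn.
    - by rewrite mulNr mulNrn.
    - by rewrite mulrN mulNrn.
  by rewrite /a negb_or => /andP[/negPf-> /negPf->].
apply: eq_bigr => l _; case: (l == k) => //.
rewrite exchange_big; apply: eq_bigr => i _; apply: eq_bigr => j _ /=.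
by rewrite tauC mulNr mulrN.
Qed.

Definition in_form k Q L := \sum_(i < n) L i *+ arr Q i k.
Definition out_form k Q L := \sum_(j < n) L j *+ arr Q k j.
Definition tpath_form k Q := \sum_(i < m) \sum_(j < m) tau i j *+ tpath Q k i j.

(** The added multiplicities [arr Q i k * arr Q k j] and [tpath Q k i j * arr Q k l] factor through
    k, so all additions assemble into one product of linear forms. *)
Lemma logform_add k Q L :
  logform (mut_add k Q) L =
  logform Q L + (in_form k Q L + tpath_form k Q) * out_form k Q L.
Proof.
rewrite /logform /= mulrDl [RHS]addrACA; congr (_ + _).
  rewrite /in_form mulr_suml -big_split; apply: eq_bigr => i _ /=.
  rewrite /out_form mulr_sumr -big_split; apply: eq_bigr => j _ /=.
  by rewrite mulrnDr mulrnAl mulrnAr -mulrnA mulnC.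
rewrite /out_form mulr_sumr -big_split; apply: eq_bigr => l _ /=.
rewrite /tpath_form mulr_suml -big_split; apply: eq_bigr => i _ /=.
rewrite mulr_suml -big_split; apply: eq_bigr => j _ /=.
by rewrite mulrnDr mulrnAl mulrnAr -mulrnA mulnC.
Qed.

(** The D D term has coefficient [arr Q k k], which vanishes. Arrows into k and 2-paths through k
    place D on the right, arrows out of k place it on the left. *)
Lemma logform_shift k Q L D : arr Q k k = 0%N ->
  logform Q (fun i => if i == k then L i + D else L i) =
  logform Q L + (in_form k Q L + tpath_form k Q) * D + D * out_form k Q L.
Proof.
move=> akk; pose d i := if i == k then D else 0.
have LE i : (if i == k then L i + D else L i) = L i + d i.
  by rewrite /d; case: ifP; rewrite ?addr0.
rewrite /logform.
under eq_bigr => i _ do under eq_bigr => j _ do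
  rewrite !LE mulrDl !mulrDr !mulrnDl.
under [X in _ + X = _]eq_bigr => l _ do
  under eq_bigr => i _ do under eq_bigr => j _ do rewrite LE mulrDr mulrnDl.
have dsum (f : 'I_n -> W) : (forall i, i != k -> f i = 0) -> \sum_i f i = f k.
  by move=> f0; rewrite (bigD1 k) //= big1 ?addr0.
have d0 i : i != k -> d i = 0 by rewrite /d => /negPf->.
have dk : d k = D by rewrite /d eqxx.
have -> : \sum_i \sum_j (L i * L j *+ arr Q i j + L i * d j *+ arr Q i j +
    (d i * L j *+ arr Q i j + d i * d j *+ arr Q i j)) =
  \sum_i \sum_j (L i * L j *+ arr Q i j) + in_form k Q L * D + D * out_form k Q L.
  under eq_bigr => i _ do rewrite !big_split /=.
  rewrite !big_split /= -!addrA; congr (_ + (_ + _)).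
    rewrite /in_form mulr_suml; apply: eq_bigr => i _.
    rewrite dsum ?dk ?mulrnAl // => j /d0->.
    by rewrite mulr0 mul0rn.
  rewrite [X in _ + X]dsum => [|i /d0 di]; last first.
    by rewrite big1 // => j _; rewrite di mul0r mul0rn.
  rewrite [X in _ + X]dsum => [|i /d0 di]; last by rewrite di mulr0 mul0rn.
  rewrite akk mulr0n addr0 dsum => [|i /d0 di]; last first.
    by rewrite big1 // => j _; rewrite di mul0r mul0rn.
  by rewrite dk /out_form mulr_sumr; apply: eq_bigr => j _; rewrite mulrnAr.
have -> : \sum_l \sum_i \sum_j
    (tau i j * L l *+ tpath Q l i j + tau i j * d l *+ tpath Q l i j) =
  \sum_l \sum_i \sum_j (tau i j * L l *+ tpath Q l i j) + tpath_form k Q * D.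
  under eq_bigr => l _ do under eq_bigr => i _ do rewrite big_split /=.
  under eq_bigr => l _ do rewrite big_split /=.
  rewrite big_split /=; congr (_ + _); rewrite dsum => [|l /d0 dl]; last first.
    by rewrite big1 // => i _; rewrite big1 // => j _; rewrite dl mulr0 mul0rn.
  rewrite dk /tpath_form mulr_suml; apply: eq_bigr => i _.
  by rewrite mulr_suml; apply: eq_bigr => j _; rewrite mulrnAl.
by rewrite mulrDl (AC (3*2) ((1*4)*(2*5)*3)).
Qed.

End QuiverForm.

(** * The exchange relation *)

(** [omega] over an arbitrary unit ring, so that the computation rests only on the sign and Leibniz
    rules listed as hypotheses below. *)
Definition quiver_form (W : unitRingType) (n m : nat) (d : W -> W) (xi : 'I_m -> W)
    (Q : quiver_data n m) (X : 'I_n -> W) : W :=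
  \sum_(i < n) \sum_(j < n) (d (X i) * d (X j) / (X i * X j)) *+ arr Q i j +
  \sum_(l < n) \sum_(i < m) \sum_(j < m)
     (d (xi i * xi j) * d (X l) / X l) *+ tpath Q l i j.

Section Invariance.
Variables (K : fieldType) (W : unitRingType) (cst : {rmorphism K -> W}).
Variables (d : {additive W -> W}) (odd_form : zmodClosed W) (n m : nat).
Variables (xi dxi : 'I_m -> W) (x : 'I_n -> K).
Implicit Types (r s : K) (v w : W) (Q : quiver_data n m).

Hypothesis cst_comm : forall r w, cst r * w = w * cst r.
Hypothesis dxi_comm : forall j w, dxi j * w = w * dxi j.
Hypothesis xi2C : forall i j, xi i * xi j = - (xi j * xi i).
Hypothesis xi2_comm : forall i j w, xi i * xi j * w = w * (xi i * xi j).
Hypothesis d_cstM : forall r s,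
  d (cst (r * s)) = d (cst r) * cst s + cst r * d (cst s).
Hypothesis d_cst_xi2 : forall r i j, d (cst r * (xi i * xi j)) =
  d (cst r) * (xi i * xi j) + cst r * d (xi i * xi j).
Hypothesis d_xi2 : forall i j, d (xi i * xi j) = dxi i * xi j - dxi j * xi i.
Hypothesis odd_anticomm : forall v w,
  v \in odd_form -> w \in odd_form -> v * w = - (w * v).
Hypothesis cstM_odd : forall r w, w \in odd_form -> cst r * w \in odd_form.
Hypothesis d_cst_odd : forall r, d (cst r) \in odd_form.
Hypothesis d_xi2_odd : forall i j, d (xi i * xi j) \in odd_form.
Hypothesis self_opp0 : forall w, w = - w -> w = 0.
Hypothesis x_neq0 : forall i, x i != 0.

(** * Logarithmic derivatives of scalars *)

Lemma cst_unit r : r != 0 -> cst r \is a GRing.unit.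
Proof. by move=> r0; apply: rmorph_unit; rewrite unitfE. Qed.

Definition dlog r : W := d (cst r) * cst r^-1.

Lemma dlog_odd r : dlog r \in odd_form.
Proof. by rewrite /dlog -cst_comm cstM_odd. Qed.

Lemma d_cst_dlog r : r != 0 -> d (cst r) = cst r * dlog r.
Proof.
move=> r0; rewrite /dlog mulrA [cst r * _]cst_comm -mulrA -rmorphM mulfV //.
by rewrite rmorph1 mulr1.
Qed.

Lemma dlogM r s : r != 0 -> s != 0 -> dlog (r * s) = dlog r + dlog s.
Proof.
move=> r0 s0; rewrite /dlog d_cstM mulrDl -mulrA -rmorphM; congr (_ + _).
  by rewrite invfM [r^-1 * _]mulrC mulrA mulfV // mul1r.
rewrite -mulrA cst_comm -mulrA -rmorphM; congr (_ * cst _).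
by rewrite invfM mulrAC mulVf // mul1r.
Qed.

Lemma dlog1 : dlog 1 = 0.
Proof.
have := dlogM (oner_neq0 K) (oner_neq0 K); rewrite mulr1 -[LHS]addr0.
by move/addrI=> <-.
Qed.

Lemma dlogX r e : r != 0 -> dlog (r ^+ e) = dlog r *+ e.
Proof.
move=> r0; elim: e => [|e IHe]; first exact: dlog1.
by rewrite exprS dlogM ?expf_neq0 // IHe mulrS.
Qed.

Lemma prod_pow_neq0 (e : 'I_n -> nat) : \prod_i x i ^+ e i != 0.
Proof. by apply/prodf_neq0 => i _; rewrite expf_neq0. Qed.

Lemma dlog_prod (e : 'I_n -> nat) :
  dlog (\prod_i x i ^+ e i) = \sum_i dlog (x i) *+ e i.
Proof.
(* Nonvanishing is carried through the induction because [dlogM] requires it. *)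
suff [] : \prod_i x i ^+ e i != 0 /\
  dlog (\prod_i x i ^+ e i) = \sum_i dlog (x i) *+ e i by [].
elim/big_ind2: _ => [|r v s w [r0 rE] [s0 sE]|i _].
- by rewrite oner_neq0 dlog1.
- by rewrite mulf_neq0 // dlogM // rE sE.
- by rewrite expf_neq0 // dlogX.
Qed.

Definition tau i j : W := d (xi i * xi j).

Lemma tauC i j : tau i j = - tau j i.
Proof. by rewrite /tau xi2C raddfN. Qed.

(** The [X i], and hence their inverses, are central, so each quotient splits into logarithmic
    factors. *)
Lemma form_logform Q X : (forall i, X i \is a GRing.unit) ->
    (forall i w, X i * w = w * X i) ->
  quiver_form d xi Q X = logform tau Q (fun i => d (X i) / X i).
Proof.
move=> XU XC; congr (_ + _).
  have VC i w : (X i)^-1 * w = w * (X i)^-1 by apply/esym/commrV/esym/XC.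
  apply: eq_bigr => i _; apply: eq_bigr => j _; congr (_ *+ _).
  by rewrite invrM // -!mulrA [in RHS]VC !mulrA.
apply: eq_bigr => l _; apply: eq_bigr => i _; apply: eq_bigr => j _.
by rewrite mulrA.
Qed.

Lemma eq_logform Q (L L' : 'I_n -> W) : L =1 L' ->
  logform tau Q L = logform tau Q L'.
Proof.
move=> LL'; congr (_ + _); apply: eq_bigr => i _; apply: eq_bigr => j _.
  by rewrite !LL'.
by apply: eq_bigr => l _; rewrite LL'.
Qed.

Section Exchange.
Variables (Q : quiver_data n m) (k : 'I_n).
Hypothesis arrkk : arr Q k k = 0%N.
Hypothesis tpath_const : exists c : nat, forall i j,
  i \in tstart Q k -> j \in tend Q k -> tpath Q k i j = c.

(** * The even nilpotent element theta *)

Definition theta : W := \sum_(i < m) \sum_(j < m) (xi i * xi j) *+ tpath Q k i j.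

Lemma theta_comm w : theta * w = w * theta.
Proof.
rewrite /theta mulr_suml mulr_sumr; apply: eq_bigr => i _.
rewrite mulr_suml mulr_sumr; apply: eq_bigr => j _.
by rewrite mulrnAl mulrnAr xi2_comm.
Qed.

Lemma d_theta : d theta = tpath_form tau k Q.
Proof.
by rewrite raddf_sum; apply: eq_bigr => i _; rewrite raddf_sum;
  apply: eq_bigr => j _; rewrite raddfMn.
Qed.

Lemma d_theta_odd : d theta \in odd_form.
Proof.
rewrite d_theta; apply: rpred_sum => i _; apply: rpred_sum => j _.
by rewrite rpredMn // d_xi2_odd.
Qed.

Lemma d_cst_theta r : d (cst r * theta) = d (cst r) * theta + cst r * d theta.
Proof.
rewrite d_theta /theta !mulr_sumr -big_split raddf_sum; apply: eq_bigr => i _ /=.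
rewrite !mulr_sumr -big_split raddf_sum; apply: eq_bigr => j _ /=.
by rewrite !mulrnAr raddfMn d_cst_xi2 mulrnDl.
Qed.

Lemma xi_sum_sqr (A : {set 'I_m}) :
  (\sum_(i in A) xi i) * (\sum_(i in A) xi i) = 0.
Proof.
apply: self_opp0; rewrite mulr_suml -sumrN.
under eq_bigr do rewrite mulr_sumr.
rewrite exchange_big; apply: eq_bigr => i _; rewrite mulr_sumr -sumrN.
by apply: eq_bigr => j _; rewrite xi2C.
Qed.

(* Equal multiplicities make theta decomposable, which is why theta and its
   differential multiply to zero. *)
Lemma theta_factor : exists c : nat,
  let alpha := \sum_(i in tstart Q k) xi i in
  let beta := \sum_(j in tend Q k) xi j in
  theta = (alpha * beta) *+ c /\
  d theta = ((\sum_(i in tstart Q k) dxi i) * beta -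
         (\sum_(j in tend Q k) dxi j) * alpha) *+ c.
Proof.
have [c cE] := tpath_const; exists c => alpha beta.
have SE : theta = (alpha * beta) *+ c.
  (* Pairs outside the product of [tstart Q k] and [tend Q k] have multiplicity 0, so the sum
     restricts to this product, where the multiplicity is c. *)
  rewrite /alpha /beta mulr_suml -sumrMnl [RHS]big_mkcond; apply: eq_bigr => i _ /=.
  case: ifP => iI; last first.
    rewrite big1 // => j _; have [-> //|/negPf tij] := eqVneq (tpath Q k i j) 0%N.
    by move: iI; rewrite inE => /existsP[]; exists j; rewrite lt0n tij.
  rewrite mulr_sumr -sumrMnl [RHS]big_mkcond; apply: eq_bigr => j _ /=.
  case: ifP => jJ; first by rewrite cE.
  have [-> //|/negPf tij] := eqVneq (tpath Q k i j) 0%N.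
  by move: jJ; rewrite inE => /existsP[]; exists i; rewrite lt0n tij.
split=> //; rewrite SE raddfMn; congr (_ *+ _).
rewrite {1}/alpha mulr_suml raddf_sum mulr_suml.
rewrite [X in _ = _ - X]mulr_suml [X in _ = _ - X](eq_bigr (fun j =>
  \sum_(i in tstart Q k) dxi j * xi i)); last by move=> j _; rewrite mulr_sumr.
rewrite [X in _ = _ - X]exchange_big -sumrB; apply: eq_bigr => i _ /=.
rewrite /beta !mulr_sumr raddf_sum -sumrB; apply: eq_bigr => j _ /=.
exact: d_xi2.
Qed.

(** With theta a multiple of alpha beta, where alpha beta is central and alpha and beta square to
    zero, every term of either product contains alpha or beta twice. *)
Lemma theta_mul0 : theta * theta = 0 /\ theta * d theta = 0.
Proof.
have [c []] := theta_factor; set a := \sum_(i in _) xi i; set b := \sum_(j in _) xi j.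
have [aa bb] : a * a = 0 /\ b * b = 0 by split; exact: xi_sum_sqr.
have abC w : a * b * w = w * (a * b).
  rewrite /a !(mulr_suml, mulr_sumr); apply: eq_bigr => i _.
  rewrite /b !(mulr_suml, mulr_sumr); apply: eq_bigr => j _.
  exact: xi2_comm.
have dC (A : {set 'I_m}) w : (\sum_(i in A) dxi i) * w = w * \sum_(i in A) dxi i.
  by rewrite mulr_suml mulr_sumr; apply: eq_bigr => i _.
move=> -> ->; split; rewrite mulrnAl mulrnAr.
  by rewrite mulrA abC mulrA aa !mul0r !mul0rn.
rewrite [X in X - _]dC [X in _ - X]dC mulrBr !mulrA -[a * b * b]mulrA bb mulr0 mul0r sub0r.
by rewrite abC mulrA aa !mul0r oppr0 !mul0rn.
Qed.

(** Since theta squares to zero, these are the polynomials in theta over [K]. The exchange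
    polynomial and x_k expressed through x_k' both have this form. *)
Definition superfun r s : W := cst r + cst s * theta.

Lemma superfun_comm r s w : superfun r s * w = w * superfun r s.
Proof.
by rewrite /superfun mulrDl mulrDr cst_comm -mulrA theta_comm !mulrA cst_comm.
Qed.

(** Multiplying by the conjugate r - s theta gives r^2, as theta^2 = 0, and a commuting factor of a
    unit is a unit. *)
Lemma superfun_unit r s : r != 0 -> superfun r s \is a GRing.unit.
Proof.
move=> r0; have [tt _] := theta_mul0.
have E : superfun r s * (superfun r (- s)) = cst r * cst r.
  rewrite /superfun rmorphN mulNr mulrDl !mulrDr !mulrN.
  have -> : cst s * theta * (cst s * theta) = 0.
    by rewrite -mulrA theta_comm -!mulrA tt !mulr0.
  rewrite oppr0 addr0 -[_ * theta * cst r]mulrA [theta * cst r]theta_comm !mulrA.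
  by rewrite [cst s * cst r]cst_comm addrNK.
have U : cst r * cst r \is a GRing.unit by rewrite unitrMl cst_unit.
have := U; rewrite -E unitrM_comm => [/andP[]//|].
exact: superfun_comm.
Qed.

(** [d_cstM] and [d_cst_xi2] cover scalars and scalar multiples of xi_i xi_j. This extends the
    Leibniz rule to the product of x_k and x_k'. *)
Lemma d_superfunM r s z : d (superfun (r * z) (s * z)) =
  d (superfun r s) * cst z + superfun r s * d (cst z).
Proof.
rewrite /superfun !raddfD /= !d_cst_theta !d_cstM rmorphM !mulrDl.
rewrite -[_ * cst z * theta]mulrA [cst z * theta]cst_comm mulrA.
rewrite -[_ * d (cst z) * theta]mulrA -[d (cst z) * theta]theta_comm mulrA.
rewrite -[_ * cst z * d theta]mulrA [cst z * d theta]cst_comm mulrA.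
by rewrite (AC (2*(2*1)) ((1*(3*5))*(2*4))).
Qed.

Lemma superfunM r s z : superfun (r * z) (s * z) = superfun r s * cst z.
Proof.
by rewrite /superfun mulrDl !rmorphM -!mulrA [theta * _]theta_comm.
Qed.

(** * The exchange polynomial and its differential *)

Let P0 : K := \prod_(j < n) x j ^+ arr Q k j.
Let M0 : K := \prod_(i < n) x i ^+ arr Q i k.
Hypothesis PM_neq0 : P0 + M0 != 0.

(** P + (1 + theta) M sorted by powers of theta; its constant part P + M decides invertibility. *)
Let E := superfun (P0 + M0) M0.
Let p := dlog P0.
Let q := dlog M0 + d theta.

(** theta d theta = 0 allows M d theta to be replaced by (1 + theta) M d theta, so that q factors
    out. *)
Lemma d_exchange : d E = cst P0 * p + (1 + theta) * cst M0 * q.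
Proof.
have [_ tdt] := theta_mul0.
rewrite /E /superfun raddfD d_cst_theta /= rmorphD raddfD /=.
rewrite !d_cst_dlog ?prod_pow_neq0 // -/P0 -/M0 -!addrA; congr (_ + _).
rewrite mulrDl mul1r [theta * cst _]theta_comm /q mulrDl !mulrDr -[_ * theta * d theta]mulrA.
rewrite tdt mulr0 addr0 -[_ * theta * dlog _]mulrA theta_comm mulrA.
by rewrite -addrA [_ * d theta + _]addrC.
Qed.

Lemma exchange_cancel : q * (d E / E) + (d E / E) * p = q * p.
Proof.
have podd : p \in odd_form by exact: dlog_odd.
have qodd : q \in odd_form by rewrite rpredD ?dlog_odd ?d_theta_odd.
have EU : E \is a GRing.unit by exact: superfun_unit.
have EVC w : E^-1 * w = w * E^-1.
  by apply/esym/commrV/esym/superfun_comm.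
have pp : p * p = 0 by exact/self_opp0/odd_anticomm.
have qq : q * q = 0 by exact/self_opp0/odd_anticomm.
have := d_exchange; clearbody p q => dE.
(* E is central and invertible, so both sides may be compared after multiplication by E. *)
rewrite -[_ / _ * p]mulrA EVC !mulrA -mulrDl.
rewrite -[RHS](mulrK EU); congr (_ * _).
set b := (1 + theta) * cst M0.
have bC w : b * w = w * b.
  have tC v : (1 + theta) * v = v * (1 + theta).
    by rewrite mulrDl mulrDr mul1r mulr1 theta_comm.
  by rewrite /b -mulrA tC cst_comm -mulrA -tC.
have EE : E = cst P0 + b.
  by rewrite /E /superfun rmorphD -addrA /b mulrDl mul1r theta_comm.
(* In q dE + dE p the terms containing p p or q q vanish, and P q p + b q p = E q p remains. *)
rewrite dE -/b mulrDr [(_ + b * q) * p]mulrDl -[_ * p * p]mulrA pp mulr0 add0r.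
rewrite [b * q]bC [q * (q * b)]mulrA qq mul0r addr0 -[q * b]bC.
rewrite EE mulrDr; congr (_ + _); first by rewrite cst_comm mulrA.
by rewrite -mulrA bC.
Qed.

(** The symbol [x k] plays the role of x_k', and [X k] that of the old x_k expressed through it by
    the exchange relation. The substitution thus becomes an equality of two forms in one ring. *)
Lemma form_mutation X : (forall i, i != k -> X i = cst (x i)) ->
    X k * cst (x k) = \prod_(j < n) X j ^+ arr Q k j +
                      (1 + theta) * \prod_(i < n) X i ^+ arr Q i k ->
  quiver_form d xi Q X = quiver_form d xi (mutation k Q) (fun i => cst (x i)).
Proof.
move=> hX hXk.
(* As there is no loop at k, the products in the exchange relation do not contain X_k, so the
   relation is solved for X_k by division. *)
have prodE (e : 'I_n -> nat) : e k = 0%N ->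
    \prod_i X i ^+ e i = cst (\prod_i x i ^+ e i).
  move=> ek; rewrite rmorph_prod; apply: eq_bigr => i _; rewrite rmorphXn /=.
  by have [->|/hX->//] := eqVneq i k; rewrite ek !expr0.
pose z := x k; have z0 : z != 0 := x_neq0 k.
have zU : cst z \is a GRing.unit := cst_unit z0.
have XkE : X k * cst z = E.
  rewrite hXk !prodE // -/P0 -/M0 /E /superfun mulrDl mul1r theta_comm rmorphD.
  by rewrite addrA.
pose r0 := (P0 + M0) / z; pose s0 := M0 / z.
have EzE : E = superfun (r0 * z) (s0 * z) by rewrite !divfK.
have XkS : X k = superfun r0 s0.
  by apply: (mulIr zU); rewrite XkE EzE superfunM.
have XU i : X i \is a GRing.unit.
  have [->|/hX->] := eqVneq i k; last exact: cst_unit.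
  by rewrite XkS superfun_unit // mulf_neq0 ?invr_eq0.
have XC i w : X i * w = w * X i.
  have [->|/hX->] := eqVneq i k; last exact: cst_comm.
  by rewrite XkS superfun_comm.
rewrite form_logform // [RHS]form_logform => [|i|i w]; last 2 first.
- exact: cst_unit.
- exact: cst_comm.
pose L i := dlog (x i).
have LE i : d (cst (x i)) / cst (x i) = L i by rewrite /L /dlog fmorphV.
rewrite [RHS](eq_logform _ LE).
have LC : anticomm_family L by move=> i j; apply: odd_anticomm; apply: dlog_odd.
(* On the mutated side, cancellation, reversal and addition are undone in turn. *)
rewrite /mutation logform_cancel ?logform_reverse //; try exact: tauC.
rewrite logform_add.
(* From E = X_k x_k', the logarithmic form of the old x_k is -L_k shifted by dE/E. *)
have DE : d E / E = d (X k) / X k + L k.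
  rewrite -LE EzE d_superfunM superfunM -XkS invrM // mulrDl !mulrA mulrK //.
  by congr (_ + _); rewrite -!mulrA XC !mulrA divrK.
rewrite (@eq_logform _ _ (fun i => if i == k then neg_at k L i + d E / E
  else neg_at k L i)); last first.
  move=> i; rewrite /neg_at; case: eqP => [->|/eqP ik]; last by rewrite hX ?LE.
  by rewrite DE addrCA addNr addr0.
rewrite logform_shift // -addrA; congr (_ + _).
(* Without a loop, the linear forms at k do not involve L_k, so its sign change is invisible and
   they are the logarithmic derivatives of M and P. *)
have negE (e : 'I_n -> nat) : e k = 0%N ->
    \sum_i neg_at k L i *+ e i = dlog (\prod_i x i ^+ e i).
  move=> ek; rewrite dlog_prod; apply: eq_bigr => i _; rewrite /neg_at.
  by case: eqP => // ->; rewrite ek.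
rewrite /in_form /out_form !negE // -d_theta.
exact: exchange_cancel.
Qed.

End Exchange.
End Invariance.

(** * The Grassmann algebra of forms as an instance *)

Lemma gr_form_mutation (K : fieldType) (R : comUnitRingType)
    (c : {rmorphism K -> R}) (m n : nat) (del : 'I_n -> {additive K -> K})
    (f : 'I_n -> {additive R -> R}) (y : 'I_m -> R) (x : 'I_n -> K)
    (delM : forall i r s, del i (r * s) = del i r * s + r * del i s)
    (fE : forall i r, f i (c r) = c (del i r)) (two_neq0 : (2 : K) != 0)
    (x_neq0 : forall i, x i != 0) (Q : quiver_data n m) (hQ : extended_quiver Q)
    (k : 'I_n)
    (PM_neq0 : \prod_j x j ^+ arr Q k j + \prod_i x i ^+ arr Q i k != 0)
    (X : 'I_n -> grassmann R (m + n))
    (hX : forall i, i != k -> X i = cst c m n (x i))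
    (hXk : X k * cst c m n (x k) = \prod_j X j ^+ arr Q k j +
      (1 + \sum_i \sum_j (@xi R m n i * xi R n j) *+ tpath Q k i j) *
      \prod_i X i ^+ arr Q i k) :
  quiver_form (gr_diff f y) (@xi R m n) Q X =
  quiver_form (gr_diff f y) (@xi R m n) (mutation k Q) (fun i => cst c m n (x i)).
Proof.
apply: (@form_mutation K (grassmann R (m + n)) (cst c m n) (gr_diff f y)
  (@gr_parity R (m + n) true) n m (@xi R m n) (@dxi R m n y) x).
- exact: cst_comm.
- exact: dxi_comm.
- exact: xi2C.
- exact: xi2_comm.
- exact: gr_diff_cstM.
- move=> r i j; apply: gr_diff_cstMl => //; exact: int_coef_xi2.
- exact: gr_diff_xi2.
- exact: gr_odd_anticomm.
- move=> r w w_odd.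
  by apply: (@gr_parityM _ _ false true); first exact: gr_parity_grC.
- exact: gr_diff_cst_odd.
- exact: gr_diff_xi2_odd.
- exact: (gr_self_opp0 c two_neq0).
- exact: x_neq0.
- exact: no_loop hQ k.
- exact: same_number hQ k.
- exact: PM_neq0.
- exact: hX.
- exact: hXk.
Qed.

Theorem theorem3p4 (F : fieldType) (charF0 : [pchar F] =i pred0) (n m : nat)
    (Q : quiver_data n m) (hQ : extended_quiver Q) (k : 'I_n)
    (X : 'I_n -> forms F n m)
    (hX : forall i : 'I_n, i != k -> X i = xvar F m i)
    (hXk : X k * xvar F m k = exchange Q k X) :
  omega Q X = omega (mutation k Q) (@xvar F n m).
Proof.
have two_neq0 : (2 : F) != 0 by rewrite (pcharf0P F).1.
have x_neq0 (i : 'I_n) : (tofrac 'X_i : ratfun F n) != 0.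
  by rewrite tofrac_eq0 -msize_poly_eq0 msizeX mdeg1.
have prodE (e : 'I_n -> nat) : \prod_i (tofrac 'X_i : ratfun F n) ^+ e i =
    tofrac (\prod_i 'X_i ^+ e i).
  by rewrite rmorph_prod; apply: eq_bigr => i _; rewrite rmorphXn.
(* P and M are monomials with coefficient 1, hence take the value 1 at the point (1, ..., 1). *)
have mevE (e : 'I_n -> nat) :
    meval (fun=> 1 : F) (\prod_i 'X_i ^+ e i : {mpoly F[n]}) = 1.
  by rewrite rmorph_prod big1 // => i _; rewrite rmorphXn /= mevalXU expr1n.
have PM_neq0 : \prod_j (tofrac 'X_j : ratfun F n) ^+ arr Q k j +
               \prod_i (tofrac 'X_i : ratfun F n) ^+ arr Q i k != 0.
  rewrite !prodE -tofracD tofrac_eq0.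
  (* At that point P + M takes the value 2, which is nonzero in characteristic zero. *)
  apply: contra_neq two_neq0 => /(congr1 (meval (fun=> 1 : F))).
  by rewrite mevalD !mevE meval0.
have two_neq0' : (2 : ratfun F n) != 0.
  by rewrite -(rmorph_nat (@FracField.tofrac {mpoly F[n]})) tofrac_eq0
    -mpolyC_nat mpolyC_eq0.
have derivE (i : 'I_n) (r : ratfun F n) :
    map_mpoly (ratfun_deriv i) (mpolyC m r) = mpolyC m (ratfun_deriv i r).
  exact: map_mpolyC.
(* [omega], [exchange] and [dform] are convertible with their abstract versions. *)
exact: (@gr_form_mutation (ratfun F n) {mpoly (ratfun F n)[m]}
  (@mpolyC m (ratfun F n)) m n (@ratfun_deriv F n)
  (fun i => map_mpoly (ratfun_deriv i)) (fun j => 'X_j)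
  (fun i => tofrac 'X_i) (@ratfun_derivM F n) derivE two_neq0' x_neq0 Q hQ k
  PM_neq0 X hX hXk).
Qed.
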